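(* Assume that $F\in L^2(\Omega;\mathbb R^3)$, $f\in L^2(\Gamma_N;\mathbb R^3)$, $\|F\|_{L^2(\Omega;\mathbb R^3)}+\|f\|_{L^2(\Gamma_N;\mathbb R^3)}>0$ and $\zeta_{lim}>0$. For $\alpha\in\mathbb R_+$ let $\psi(\alpha)\in\mathcal D$ be the unique minimizer over $\mathcal D$ of $\tilde\zeta\mapsto\phi(\tilde\zeta)-\alpha\tilde\zeta$. Then: (i) the function $\psi:\mathbb R_+\to\mathcal D$ is continuous and nondecreasing in $\mathbb R_+$; (ii) $\psi(\alpha)\to\zeta_{lim}$ as $\alpha\to+\infty$ (where $\zeta_{lim}\in(0,+\infty]$).
   Context: $\mathbb R_+=[0,+\infty)$. $\Omega\subset\mathbb R^3$ is a bounded domain with Lipschitz boundary $\partial\Omega=\overline{\Gamma}_D\cup\overline{\Gamma}_N$, where $\Gamma_D,\Gamma_N$ are relatively open, disjoint, and $\Gamma_D$ has positive surface measure. $\mathbb R^{3\times3}_{sym}$ is the space of symmetric $3\times3$ matrices with scalar product $\eta:\xi=\eta_{ij}\xi_{ij}$. $C:\mathbb R^{3\times3}_{sym}\to\mathbb R^{3\times3}_{sym}$ is a linear map (independent of $x$), symmetric ($C\eta:\xi=\eta:C\xi$) and positive definite ($C\eta:\eta\ge\delta\,\eta:\eta$ for some $\delta>0$). $S=L^2(\Omega;\mathbb R^{3\times3}_{sym})$ with $\langle\tau,e\rangle=\int_\Omega\tau:e\,dx$, and $\|\tau\|_{C^{-1}}=\langle C^{-1}\tau,\tau\rangle^{1/2}$.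 $\mathbb V=\{v\in H^1(\Omega;\mathbb R^3): v=0\text{ on }\Gamma_D\}$, $\varepsilon(v)=\frac12(\nabla v+(\nabla v)^T)$, $L(v)=\int_\Omega F\cdot v\,dx+\int_{\Gamma_N}f\cdot v\,ds$. $\Phi:\mathbb R^{3\times3}_{sym}\to\mathbb R$ is a continuous convex function with $\Phi(0)=0$, and $\gamma>0$ is a constant. $P=\{\tau\in S:\Phi(\tau(x))\le\gamma\text{ for a.a. }x\in\Omega\}$. For $\zeta\in\mathbb R_+$, $\Lambda_{\zeta L}=\{\tau\in S:\langle\tau,\varepsilon(v)\rangle=\zeta L(v)\ \forall v\in\mathbb V\}$. $\mathcal I(\tau)=\frac12\|\tau\|_{C^{-1}}^2$. $\mathcal D=\{\zeta\in\mathbb R_+:\Lambda_{\zeta L}\cap P\neq\emptyset\}$ and $\zeta_{lim}=\sup\mathcal D\in[0,+\infty]$. For $\zeta\in\mathcal D$, $\sigma(\zeta)$ is the unique minimizer of $\mathcal I$ over $\Lambda_{\zeta L}\cap P$. The function $\phi:\mathbb R\to\overline{\mathbb R}$ is defined by $\phi(\zeta)=\mathcal I(\sigma(\zeta))$ for $\zeta\in\mathcal D$ and $\phi(\zeta)=+\infty$ otherwise. For every $\alpha\in\mathbb R_+$ the function $\tilde\zeta\mapsto\phi(\tilde\zeta)-\alpha\tilde\zeta$ has a unique minimizer in $\mathcal D$, so $\psi$ is well defined. *)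

(* Defs.v *)
From HB Require Import structures.
From mathcomp Require Import all_boot all_order all_algebra.
From mathcomp Require Import all_classical all_reals all_analysis.

Set Implicit Arguments.
Unset Strict Implicit.
Unset Printing Implicit Defensive.

Import Order.TTheory GRing.Theory Num.Theory.
Import numFieldNormedType.Exports.

Local Open Scope classical_set_scope.
Local Open Scope ring_scope.

(* R^3 is the iterated product R * R * R, which carries both the library's
   product topology and its product (Borel) sigma-algebra. The library norm on
   it is the max norm, so Euclidean lengths are written out. *)
Notation vec3 R := (R * R * R)%type.

Section matrices.
Context {R : realType}.

(* The scalar product A_ij B_ij; for row vectors, the Euclidean one. *)
Definition ddot m n (A B : 'M[R]_(m, n)) : R :=
  \sum_(i < m) \sum_(j < n) A i j * B i j.

Definition symmx : set 'M[R]_3 := [set A | A^T = A].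

(* A linear map on symmetric matrices is represented by a linear map on all
   matrices that leaves [symmx] invariant; only its values on [symmx] matter. *)
Definition symm_posdef (C : {linear 'M[R]_3 -> 'M[R]_3}) : Prop :=
  [/\ forall A, symmx A -> symmx (C A),
      forall A B, symmx A -> symmx B -> ddot (C A) B = ddot A (C B) &
      exists2 delta : R, 0 < delta &
        forall A, symmx A -> delta * ddot A A <= ddot (C A) A].

(* The inverse of C as a map of [symmx] to itself. *)
Definition symm_inv (C : {linear 'M[R]_3 -> 'M[R]_3}) (A : 'M[R]_3) : 'M[R]_3 :=
  xget 0 [set B | symmx B /\ C B = A].

End matrices.

Section L2.
Context {R : realType} {d} {T : measurableType d}.
Context (mu : {measure set T -> \bar R}) (D : set T) {m n : nat}.
Implicit Types u w : T -> 'M[R]_(m, n).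

Definition L2 : set (T -> 'M[R]_(m, n)) :=
  [set u : T -> 'M[R]_(m, n) |
           (forall i j, measurable_fun D (fun x => u x i j)) /\
           (\int[mu]_(x in D) (ddot (u x) (u x))%:E < +oo)%E].

Definition L2dot u w : R := \int[mu]_(x in D) ddot (u x) (w x).

Definition L2norm u : R := Num.sqrt (L2dot u u).

Definition L2cvg (u_ : nat -> T -> 'M[R]_(m, n)) w : Prop :=
  (fun k => \int[mu]_(x in D) (ddot (u_ k x - w x) (u_ k x - w x))%:E)%E @ \oo
    --> 0%E.

End L2.

Section geometry.
Context {R : realType}.
Implicit Types (p x y : vec3 R) (A : set (vec3 R)).

Definition coord x : 'rV[R]_3 := \row_j nth 0 [:: x.1.1; x.1.2; x.2] j.

Definition basis (j : 'I_3) : vec3 R :=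
  ((nat_of_ord j == 0%N)%:R, (nat_of_ord j == 1%N)%:R,
   (nat_of_ord j == 2%N)%:R).

Definition edist x y : R := Num.sqrt (ddot (coord x - coord y) (coord x - coord y)).

Definition lebesgue3 : {measure set _ -> \bar R} :=
  ((@lebesgue_measure R \x @lebesgue_measure R) \x @lebesgue_measure R)%E.

Definition boundary A : set (vec3 R) := closure A `\` A°.

(* Euclidean diameter; 0 for the empty set. *)
Definition ediam A : \bar R :=
  ereal_sup (0%E |` [set (edist x y)%:E | x in A & y in A]).

(* Size-delta approximation of the 2-dimensional Hausdorff measure. The factor
   pi / 4 (a disc of diameter 1) makes it agree with surface area. *)
Definition hausdorff2_pre (delta : R) A : \bar R :=
  ereal_inf [set (\sum_(k <oo) ((pi / 4)%:E * (ediam (U k) * ediam (U k))))%E |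
    U in [set U : nat -> set (vec3 R) |
            A `<=` \bigcup_k U k /\ forall k, (ediam (U k) <= delta%:E)%E]].

Definition hausdorff2 A : \bar R :=
  ereal_sup [set hausdorff2_pre delta A | delta in [set delta : R | 0 < delta]].

End geometry.
Section surface_measure.
Context {R : realType}.
Implicit Types (A B : set (vec3 R)) (delta : R).
Local Open Scope ereal_scope.

Let area A : \bar R := (pi / 4)%:E * (ediam A * ediam A).

Let gauge delta A : \bar R := if ediam A <= delta%:E then area A else +oo.

Let ediam_ge0 A : 0 <= ediam A.
Proof. by apply: ereal_sup_ubound; left. Qed.

Let area_ge0 A : 0 <= area A.
Proof.
by rewrite /area mule_ge0 ?mule_ge0 ?ediam_ge0// lee_fin divr_ge0// pi_ge0.
Qed.

Let gauge_ge0 delta A : 0 <= gauge delta A.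
Proof. by rewrite /gauge; case: ifP. Qed.

Let ediam0 : ediam (set0 : set (vec3 R)) = 0.
Proof.
apply/eqP; rewrite eq_le ediam_ge0 andbT.
by apply: ge_ereal_sup => x /= [->//|[? []]].
Qed.

Let gauge0 delta : (0 < delta)%R -> gauge delta set0 = 0.
Proof. by move=> d0; rewrite /gauge /area ediam0 !mule0 lee_fin ltW. Qed.

Let all_sets := g_sigma_algebraType (@setT (set (vec3 R))).

Let hausdorff2_preE delta A :
  hausdorff2_pre delta A = @mu_ext _ all_sets R (gauge delta) A.
Proof.
rewrite /hausdorff2_pre /mu_ext.
have areaE (U : nat -> set (vec3 R)) : (forall k, ediam (U k) <= delta%:E) ->
    \sum_(k <oo) gauge delta (U k) = \sum_(k <oo) area (U k).
  by move=> Ud; apply: eq_eseriesr => k _; rewrite /gauge Ud.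
apply/eqP; rewrite eq_le; apply/andP; split.
- apply: le_ereal_inf_tmp => x [U [_ AU] <-].
  have [Ud|] := pselect (forall k, ediam (U k) <= delta%:E).
    by apply: ereal_inf_lbound; exists U; rewrite ?areaE.
  move=> /existsNP[k /negP Uk].
  rewrite (@eseries_pinfty _ _ xpredT k) ?leey//; last first.
    by rewrite /gauge (negbTE Uk).
  by move=> n _; rewrite -ltNye (lt_le_trans _ (gauge_ge0 _ _)).
- apply: le_ereal_inf_tmp => x [U [AU Ud] <-].
  apply: ereal_inf_lbound; exists U; last by rewrite areaE.
  by split => // k; exact: sub_sigma_algebra.
Qed.

Let hausdorff2_pre_le delta A : (0 < delta)%R ->
  hausdorff2_pre delta A <= hausdorff2 A.
Proof. by move=> d0; apply: ereal_sup_ubound; exists delta. Qed.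

Let hausdorff2_set0 : hausdorff2 (set0 : set (vec3 R)) = 0.
Proof.
apply/eqP; rewrite eq_le; apply/andP; split.
  apply: ge_ereal_sup => _ [delta d0 <-]; rewrite hausdorff2_preE.
  by rewrite mu_ext0// gauge0.
apply: le_trans (hausdorff2_pre_le _ ltr01).
by rewrite hausdorff2_preE; exact: mu_ext_ge0.
Qed.

Let hausdorff2_ge0 A : 0 <= hausdorff2 A.
Proof.
apply: le_trans (hausdorff2_pre_le _ ltr01).
by rewrite hausdorff2_preE; exact: mu_ext_ge0.
Qed.

Let le_hausdorff2 : {homo @hausdorff2 R : A B / A `<=` B >-> A <= B}.
Proof.
move=> A B AB; apply: ge_ereal_sup => _ [delta d0 <-].
apply: le_trans (hausdorff2_pre_le _ d0).
by rewrite !hausdorff2_preE; exact: le_mu_ext.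
Qed.

Let hausdorff2_sigma_subadditive : sigma_subadditive (@hausdorff2 R).
Proof.
move=> U; apply: ge_ereal_sup => _ [delta d0 <-]; rewrite hausdorff2_preE.
apply: le_trans (@mu_ext_sigma_subadditive _ all_sets R _ (gauge_ge0 delta) _) _.
apply: lee_nneseries => [k _ _|k _]; first exact: mu_ext_ge0.
by rewrite -hausdorff2_preE; exact: hausdorff2_pre_le.
Qed.

HB.instance Definition _ := isOuterMeasure.Build R (vec3 R) (@hausdorff2 R)
  hausdorff2_set0 hausdorff2_ge0 le_hausdorff2 hausdorff2_sigma_subadditive.

(* R^3 with the Caratheodory sigma-algebra of [hausdorff2], which contains the
   Borel sets because [hausdorff2] is a metric outer measure. *)
Definition surface_space : measurableType _ := caratheodory_type (@hausdorff2 R).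

Definition surface_measure : set surface_space -> \bar R := @hausdorff2 R.

HB.instance Definition _ := isMeasure.Build _ _ _ surface_measure
  (@caratheodory_measure0 _ _ (@hausdorff2 R))
  (@caratheodory_measure_ge0 _ _ (@hausdorff2 R))
  (@caratheodory_measure_sigma_additive _ _ (@hausdorff2 R)).

End surface_measure.

(* The orthogonal change of coordinates Q puts the boundary near p in the form
   of a Lipschitz graph y_2 = g (y_0, y_1), with Omega on one side of it. *)
Definition lipschitz_boundary {R : realType} (Omega : set (vec3 R)) : Prop :=
  forall p, boundary Omega p ->
  exists (Q : 'M[R]_3) (g : R -> R -> R) (K r h : R),
    [/\ Q *m Q^T = 1%:M, 0 < r, 0 < h,
        forall a b c d, `|g a b - g c d| <= K * (`|a - c| + `|b - d|) &
        forall x, let y := (coord x - coord p) *m Q in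
          `|y 0 0| < r -> `|y 0 1| < r -> `|y 0 2| < h ->
          (Omega x <-> g (y 0 0) (y 0 1) < y 0 2)].

(* Gamma is open in the relative topology of S. *)
Definition relatively_open {R : realType} (S Gamma : set (vec3 R)) : Prop :=
  exists2 U, open U & Gamma = U `&` S.

Section sobolev.
Context {R : realType}.
Implicit Types (Omega : set (vec3 R)) (v u g : vec3 R -> 'rV[R]_3)
  (phi : vec3 R -> R) (G : vec3 R -> 'M[R]_3).

Definition partials (s : seq 'I_3) phi : vec3 R -> R :=
  foldr (fun j psi => 'D_(basis j) psi) phi s.

Definition smooth phi : Prop := forall s x, differentiable (partials s phi) x.

Definition test_function Omega : set (vec3 R -> R) :=
  [set phi | smooth phi /\
    exists2 K, compact K /\ K `<=` Omega & forall x, ~ K x -> phi x = 0].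

(* (G x) i j is the weak partial derivative of v_i in direction j. *)
Definition is_weak_grad Omega v G : Prop :=
  forall phi, test_function Omega phi -> forall i j : 'I_3,
    \int[lebesgue3]_(x in Omega) (v x 0 i * 'D_(basis j) phi x) =
    - \int[lebesgue3]_(x in Omega) (G x i j * phi x).

Definition H1 Omega : set (vec3 R -> 'rV[R]_3) :=
  [set v | L2 lebesgue3 Omega v /\
    exists2 G, L2 lebesgue3 Omega G & is_weak_grad Omega v G].

(* Unique up to almost everywhere equality, like [trace] below. *)
Definition weak_grad Omega v : vec3 R -> 'M[R]_3 :=
  xget (fun=> 0) [set G | L2 lebesgue3 Omega G /\ is_weak_grad Omega v G].

Definition classical_grad u (x : vec3 R) : 'M[R]_3 :=
  \matrix_(i, j) 'D_(basis j) (fun y => u y 0 i) x.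

(* The trace operator is the continuous extension to H^1(Omega) of the
   restriction to the boundary; restrictions of smooth functions on R^3 are
   dense in H^1(Omega) when Omega is bounded with Lipschitz boundary. *)
Definition is_trace Omega v g : Prop :=
  L2 surface_measure (boundary Omega) g /\
  exists u_ : nat -> vec3 R -> 'rV[R]_3,
    [/\ forall k i, smooth (fun x => u_ k x 0 i),
        L2cvg lebesgue3 Omega u_ v,
        L2cvg lebesgue3 Omega (fun k => classical_grad (u_ k))
          (weak_grad Omega v) &
        L2cvg surface_measure (boundary Omega) u_ g].

Definition trace Omega v : vec3 R -> 'rV[R]_3 :=
  xget (fun=> 0) [set g | is_trace Omega v g].

Definition displacements Omega (GammaD : set (vec3 R)) :
    set (vec3 R -> 'rV[R]_3) :=
  [set v | H1 Omega v /\
    {ae surface_measure, forall x, GammaD x -> trace Omega v x = 0}].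

Definition strain Omega v (x : vec3 R) : 'M[R]_3 :=
  2^-1 *: (weak_grad Omega v x + (weak_grad Omega v x)^T).

End sobolev.

Section plasticity.
Context {R : realType}.
Context (Omega GammaD GammaN : set (vec3 R)).
Context (C : {linear 'M[R]_3 -> 'M[R]_3}) (Phi : 'M[R]_3 -> R) (gamma : R).
Context (F f : vec3 R -> 'rV[R]_3).
Implicit Types (tau : vec3 R -> 'M[R]_3) (v : vec3 R -> 'rV[R]_3) (zeta : R).

Definition stresses : set (vec3 R -> 'M[R]_3) :=
  [set tau | L2 lebesgue3 Omega tau /\ forall x, Omega x -> symmx (tau x)].

Definition load v : R :=
  L2dot lebesgue3 Omega F v + L2dot surface_measure GammaN f (trace Omega v).

Definition equilibrium zeta : set (vec3 R -> 'M[R]_3) :=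
  [set tau | stresses tau /\ forall v, displacements Omega GammaD v ->
    L2dot lebesgue3 Omega tau (strain Omega v) = zeta * load v].

Definition plastic : set (vec3 R -> 'M[R]_3) :=
  [set tau | stresses tau /\
    {ae lebesgue3, forall x, Omega x -> Phi (tau x) <= gamma}].

Definition Cinv_norm tau : R :=
  Num.sqrt (L2dot lebesgue3 Omega (fun x => symm_inv C (tau x)) tau).

Definition energy tau : R := 2^-1 * Cinv_norm tau ^+ 2.

Definition load_domain : set R :=
  [set zeta | 0 <= zeta /\ equilibrium zeta `&` plastic !=set0].

Definition zeta_lim : \bar R := ereal_sup [set zeta%:E | zeta in load_domain].

Definition ae_eq_on tau1 tau2 : Prop :=
  {ae lebesgue3, forall x, Omega x -> tau1 x = tau2 x}.

(* The minimal energy at load level zeta, where [sigma zeta] is meant to minimize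
   [energy] over the admissible stresses; +oo outside [load_domain]. *)
Definition min_energy (sigma : R -> vec3 R -> 'M[R]_3) zeta : \bar R :=
  if zeta \in load_domain then (energy (sigma zeta))%:E else +oo%E.

End plasticity.

(* x minimizes J over A, and every minimizer is E-equivalent to x. *)
Definition unique_minimizer {T : Type} {disp : Order.disp_t}
    {Y : porderType disp} (E : T -> T -> Prop) (A : set T) (J : T -> Y) (x : T)
    : Prop :=
  [/\ A x, forall y, A y -> (J x <= J y)%O &
      forall y, A y -> (J y <= J x)%O -> E y x].

(* Main.v *)
From HB Require Import structures.
Require Import Defs.
From mathcomp Require Import all_boot all_order all_algebra.
From mathcomp Require Import all_classical all_reals all_analysis.
From mathcomp Require Import measurable_realfun.
From mathcomp Require Import ring lra.
Set Implicit Arguments.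
Unset Strict Implicit.
Unset Printing Implicit Defensive.
Import Order.TTheory GRing.Theory Num.Theory.
Import numFieldNormedType.Exports.
Local Open Scope classical_set_scope.
Local Open Scope ring_scope.

(* Convex combinations of admissible stresses are admissible for the combined
   load, and the elastic energy is a nonnegative convex quadratic form; hence D
   is convex and phi is finite, nonnegative and convex on D. The rest is convex
   analysis on the line for psi a = argmin (phi - a id): adding the minimality
   inequalities of psi a and psi b gives monotonicity; by convexity, a jump of psi
   at a would produce a second minimizer for the tilt a; and if psi stayed below
   some w < z with z in D, then a (z - w) <= phi z for all a. *)

(** * Tilted minimizers of a convex function on the line *)

Section tilted_minimizers.
Context {R : realType} (D : set R) (e psi : R -> R).

(** Convexity of D is part of it, since the total function [e] is meaningful only on D. *)
Definition convex_on := forall t x y : R, 0 <= t <= 1 -> D x -> D y ->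
  D (t * x + (1 - t) * y) /\
  e (t * x + (1 - t) * y) <= t * e x + (1 - t) * e y.

Hypothesis e_convex : convex_on.
Hypothesis psi_min : forall a, 0 <= a ->
  unique_minimizer eq D (fun z => e z - a * z) (psi a).

Let psiD a : 0 <= a -> D (psi a).
Proof. by move=> /psi_min[]. Qed.

Lemma tilted_minimizer_homo : {in `[0, +oo[ &, {homo psi : a b / a <= b}}.
Proof.
move=> a b; rewrite !in_itv/= !andbT => a0 b0; rewrite le_eqVlt => /predU1P[->//|ab].
have [Da mina _] := psi_min a0; have [Db minb _] := psi_min b0.
rewrite leNgt; apply/negP => lt_psi.
have h1 := mina _ Db; have h2 := minb _ Da.
have : 0 < (b - a) * (psi a - psi b) by rewrite mulr_gt0 ?subr_gt0.
nra.
Qed.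

(** On the segment from x to its minimizer psi a, the convex function e - a id stays below its value
    at x. *)
Let tilted_between a x z : 0 <= a -> D x ->
  x <= z <= psi a \/ psi a <= z <= x ->
  D z /\ e z - a * z <= e x - a * x.
Proof.
move=> a0 Dx xz; have [Dm minm _] := psi_min a0.
have [mx|mx] := eqVneq (psi a) x.
  have -> : z = x by rewrite mx in xz; apply/eqP; rewrite eq_le; case: xz => /andP[-> ->].
  by [].
(* The weight of x in z; the case psi a = x was set aside because of this quotient. *)
pose t := (psi a - z) / (psi a - x).
have mx0 : psi a - x != 0 by rewrite subr_eq0.
have t01 : 0 <= t <= 1.
  case: xz => /andP[xz zm].
    have dgt0 : 0 < psi a - x by rewrite lt_def mx0 subr_ge0 (le_trans xz).
    by rewrite /t divr_ge0 ?subr_ge0 ?(ltW dgt0)//= ?ler_pdivrMr// ?mul1r ?lerB// -subr_ge0 ltW.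
  have dgt0 : 0 < x - psi a by rewrite lt_def subr_eq0 eq_sym mx subr_ge0 (le_trans xz).
  rewrite /t -mulrNN -invrN !opprB divr_ge0 ?subr_ge0 ?(ltW dgt0)//=.
    by rewrite ler_pdivrMr// mul1r lerB.
  by rewrite -subr_ge0 ltW.
have zE : z = t * x + (1 - t) * psi a by rewrite /t; field.
have [Dz ez] := e_convex t01 Dx Dm; rewrite -zE in Dz ez.
split=> //; have := minm _ Dx => mx_le.
have /andP[t0 t1] := t01.
have : (1 - t) * (e (psi a) - a * psi a) <= (1 - t) * (e x - a * x).
  by rewrite ler_wpM2l// subr_ge0.
rewrite [in a * z]zE; nra.
Qed.

Let psi_homo a b : 0 <= a -> a <= b -> psi a <= psi b.
Proof.
move=> a0 ab; apply: tilted_minimizer_homo => //.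
  by rewrite in_itv/= a0.
by rewrite in_itv/= (le_trans a0 ab).
Qed.

(* A jump of psi at a would leave room for a point z strictly between psi a and
   all the psi b on the other side; by convexity z would do as well as psi a
   for the tilts b, hence, letting b tend to a, for the tilt a. *)
Let psi_right a eps : 0 <= a -> 0 < eps -> exists2 b, a < b & psi b < psi a + eps.
Proof.
move=> a0 eps0; apply: contrapT => noj.
have far b : a < b -> psi a + eps <= psi b.
  by move=> ab; rewrite leNgt; apply/negP => ?; apply: noj; exists b.
have [Da mina uniqa] := psi_min a0.
have lim b : a < b -> D (psi a + eps) /\
    e (psi a + eps) - b * (psi a + eps) <= e (psi a) - b * psi a.
  move=> ab; apply: tilted_between => //; first exact: le_trans (ltW ab).
  by left; rewrite lerDl (ltW eps0) far.
have [Dz _] := lim (a + 1) ltac:(by rewrite ltrDl).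
suff : psi a + eps = psi a by move/eqP; rewrite -subr_eq0 addrAC subrr add0r gt_eqF.
apply: uniqa => //; apply/ler_addgt0Pr => d d0.
(* This tilt b turns the inequality for b into the one for a, with excess (b - a) eps = d. *)
have [|_] := lim (a + d / eps); first by rewrite ltrDl divr_gt0.
have -> : (a + d / eps) * (psi a + eps) = (a + d / eps) * psi a + a * eps + d.
  by field; rewrite gt_eqF.
lra.
Qed.

Let psi_left a eps : 0 < a -> 0 < eps ->
  exists2 b, 0 <= b < a & psi a - eps < psi b.
Proof.
move=> a0 eps0; apply: contrapT => noj.
have far b : 0 <= b < a -> psi b <= psi a - eps.
  by move=> ab; rewrite leNgt; apply/negP => ?; apply: noj; exists b.
have [Da mina uniqa] := psi_min (ltW a0).
have lim b : 0 <= b < a -> D (psi a - eps) /\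
    e (psi a - eps) - b * (psi a - eps) <= e (psi a) - b * psi a.
  move=> ab; apply: tilted_between => //; first by case/andP: ab.
  by right; rewrite far//= gerBl ltW.
have [Dz _] := lim 0 ltac:(by rewrite lexx).
suff : psi a - eps = psi a by move/eqP; rewrite -subr_eq0 addrAC subrr add0r oppr_eq0 gt_eqF.
apply: uniqa => //; apply/ler_addgt0Pr => d d0.
(* The maximum with 0 keeps the tilt in R_+; the excess is then at most d. *)
have [|_] := lim (Num.max 0 (a - d / eps)).
  by rewrite le_max lexx/= gt_max a0/= ltrBlDr ltrDl divr_gt0.
have : a - d / eps <= Num.max 0 (a - d / eps) by rewrite le_max lexx orbT.
move: (Num.max _ _) => b; rewrite lerBlDr -lerBlDl ler_pdivlMr//; nra.
Qed.

(** Monotonicity traps psi x between psi c and psi b for c < x < b; at the endpoint 0 only the right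
    side matters. *)
Lemma tilted_minimizer_continuous : {within `[0, +oo[, continuous psi}.
Proof.
apply/continuous_within_itvcyP; split.
  move=> a; rewrite in_itv/= andbT => a0.
  apply/cvgrPdist_lt => eps eps0.
  have [b ab psib] := psi_right (ltW a0) eps0.
  have [c /andP[c0 ca] psic] := psi_left a0 eps0.
  near=> x.
  have : x \in `]c, b[ by near: x; apply: near_in_itvoo; rewrite in_itv/= ca.
  rewrite in_itv/= => /andP[cx xb].
  have := psi_homo c0 (ltW cx).
  have := psi_homo (le_trans c0 (ltW cx)) (ltW xb).
  by rewrite distrC ltr_distl => ? ?; apply/andP; split; lra.
apply/cvgrPdist_lt => eps eps0.
have [b ab psib] := psi_right (lexx 0) eps0.
near=> x.
have xb : x < b by near: x; exact: nbhs_right_lt.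
have x0 : 0 < x by near: x; exact: nbhs_right_gt.
have := psi_homo (ltW x0) (ltW xb).
have := psi_homo (lexx 0) (ltW x0).
by rewrite distrC ltr_distl => ? ?; apply/andP; split; lra.
Unshelve. all: by end_near. Qed.

(** Testing minimality against z gives a (z - psi a) <= e z. *)
Let psi_unbounded_tilt z w : (forall x, D x -> 0 <= e x) -> D z -> w < z ->
  \forall a \near +oo, w <= psi a.
Proof.
move=> e0 Dz wz; near=> a.
have a0 : 0 < a by near: a; apply: nbhs_pinfty_gt; exact: num_real.
(* Beyond this threshold a (z - w) > e z, which excludes psi a < w. *)
have ae : e z / (z - w) < a by near: a; apply: nbhs_pinfty_gt; exact: num_real.
have [Da mina _] := psi_min (ltW a0).
have := mina _ Dz; have := e0 _ Da.
rewrite ltr_pdivrMr ?subr_gt0// in ae.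
move=> ea0 eza; rewrite leNgt; apply/negP => psiw.
have : 0 < a * (w - psi a) by rewrite mulr_gt0// subr_gt0.
nra.
Unshelve. all: by end_near. Qed.

(** As an element of D, psi a is bounded by the supremum, and it eventually reaches every real
    number below it. *)
Lemma tilted_minimizer_cvg : (forall x, D x -> 0 <= e x) ->
  (psi a)%:E @[a --> +oo] --> ereal_sup [set z%:E | z in D].
Proof.
move=> e0; set s := ereal_sup _.
have Ds z : D z -> (z%:E <= s)%E by move=> Dz; apply: ereal_sup_ubound; exists z.
have near_s w : (w%:E < s)%E -> \forall a \near +oo, w <= psi a.
  move=> /ereal_sup_gt[_ [z Dz <-]]; rewrite lte_fin; exact: psi_unbounded_tilt.
case: s => [s| |] in Ds near_s *.
- apply: cvg_EFin; first by near=> a.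
  apply/cvgrPdist_le => eps eps0; near=> a.
  have a0 : 0 <= a by near: a; apply: nbhs_pinfty_ge; exact: num_real.
  have : psi a <= s by have := Ds _ (psiD a0); rewrite lee_fin.
  have : s - eps <= psi a.
    by near: a; apply: near_s; rewrite lte_fin ltrBlDr ltrDl.
  by move=> h1 h2; rewrite /= ler_distl; lra.
- apply/cvgeyPge => w; near=> a; rewrite lee_fin; near: a.
  by apply: near_s; rewrite ltry.
(* The supremum is not -oo, as psi 0 lies in D. *)
- by have := Ds _ (psiD (lexx 0)).
Unshelve. all: by end_near. Qed.

End tilted_minimizers.

(** * Borel measurability of open subsets of R^3 *)

Lemma vec3_open_measurable (R : realType) (A : set (vec3 R)) :
  open A -> measurable A.
Proof.
move=> oA.
(* Balls with rational centres and radii 1 / (n + 1): countably many, and for the max norm products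
   of intervals, hence measurable. *)
pose B (i : rat * rat * rat * nat) : set (vec3 R) :=
  ball ((ratr i.1.1.1, ratr i.1.1.2, ratr i.1.2) : vec3 R) i.2.+1%:R^-1.
suff -> : A = \bigcup_i (if `[< B i `<=` A >] then B i else set0).
  apply: countable_bigcupT_measurable => // i; case: ifP => // _.
  have -> : B i = (ball (ratr i.1.1.1 : R) i.2.+1%:R^-1 `*`
      ball (ratr i.1.1.2 : R) i.2.+1%:R^-1) `*` ball (ratr i.1.2 : R) i.2.+1%:R^-1.
    by apply/seteqP; split => -[[x y] z] /= [[]].
  by apply: measurableX; [apply: measurableX|]; exact: measurable_ball.
apply/seteqP; split => [x Ax|x [i _]]; last by case: ifP => // /asboolP + Bx; exact.
have /nbhs_ballP[e /= e0 eA] := open_nbhs_nbhs (conj oA Ax).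
(* Half of e, because x and y both lie within 1 / (n + 1) of the rational centre. *)
have [n ne] : exists n, n.+1%:R^-1 < e / 2.
  by have /ltr_add_invr[n] := divr_gt0 e0 (ltr0Sn R 1); rewrite add0r; exists n.
have approx (a : R) : exists q : rat, ball (ratr q : R) n.+1%:R^-1 a.
  have /rat_in_itvoo[q] : a - n.+1%:R^-1 < a + n.+1%:R^-1.
    by rewrite ltrBlDr -addrA ltrDl addr_gt0.
  rewrite in_itv/= => /andP[qa aq]; exists q.
  by rewrite /ball/= distrC ltr_distl ltrBlDr aq -ltrBlDr qa.
have [q1 h1] := approx x.1.1; have [q2 h2] := approx x.1.2; have [q3 h3] := approx x.2.
have Bx : B (q1, q2, q3, n) x by [].
exists (q1, q2, q3, n) => //.
case: ifPn => // /asboolP; case => y By; apply: eA.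
rewrite [e]splitr; apply: ball_triangle (le_ball (ltW ne) By).
exact: ball_sym (le_ball (ltW ne) Bx).
Qed.

(** * The scalar product of matrices *)

Section ddot_theory.
Context {R : realType} {m n : nat}.
Implicit Types A B W : 'M[R]_(m, n).

Lemma ddotC A B : ddot A B = ddot B A.
Proof. by apply: eq_bigr => i _; apply: eq_bigr => j _; rewrite mulrC. Qed.

Lemma ddot_linearl a b A B W :
  ddot (a *: A + b *: B) W = a * ddot A W + b * ddot B W.
Proof.
rewrite /ddot !mulr_sumr -big_split; apply: eq_bigr => i _ /=.
rewrite !mulr_sumr -big_split; apply: eq_bigr => j _ /=.
by rewrite !mxE mulrDl !mulrA.
Qed.

Lemma ddot0l A : ddot 0 A = 0.
Proof. by apply: big1 => k _; apply: big1 => l _; rewrite mxE mul0r. Qed.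

Lemma ddot_linearr a b A B W :
  ddot W (a *: A + b *: B) = a * ddot W A + b * ddot W B.
Proof. by rewrite ddotC ddot_linearl !(ddotC W). Qed.

Lemma ddot_ge0 A : 0 <= ddot A A.
Proof. by do 2 apply: sumr_ge0 => ? _; rewrite -expr2 sqr_ge0. Qed.

Lemma sqr_entry_le_ddot A i j : A i j ^+ 2 <= ddot A A.
Proof.
rewrite /ddot (bigD1 i)//= (bigD1 j)//= expr2 -addrA lerDl addr_ge0//.
  by apply: sumr_ge0 => ? _; rewrite -expr2 sqr_ge0.
by do 2 apply: sumr_ge0 => ? _; rewrite -expr2 sqr_ge0.
Qed.

Lemma ddot_eq0 A : ddot A A <= 0 -> A = 0.
Proof.
move=> A0; apply/matrixP => i j; rewrite mxE; apply/eqP; rewrite -sqrf_eq0.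
by rewrite eq_le sqr_ge0 andbT (le_trans (sqr_entry_le_ddot A i j)).
Qed.

Lemma ddot_tr A B : ddot A^T B^T = ddot A B.
Proof.
rewrite /ddot exchange_big; apply: eq_bigr => i _; apply: eq_bigr => j _.
by rewrite !mxE.
Qed.

End ddot_theory.

(** * Square-integrable matrix fields *)

Section L2_theory.
Context {R : realType} {d} {T : measurableType d}.
Context (mu : {measure set T -> \bar R}) (D : set T) (mD : measurable D).
Local Notation integrable f := (mu.-integrable D (EFin \o f)).

Section rectangular.
Context {m n : nat}.
Implicit Types u w : T -> 'M[R]_(m, n).

Let measurable_ddot u w :
  (forall i j, measurable_fun D (fun x => u x i j)) ->
  (forall i j, measurable_fun D (fun x => w x i j)) ->
  measurable_fun D (fun x => ddot (u x) (w x)).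
Proof.
move=> mu_ mw; apply: measurable_sum => i; apply: measurable_sum => j.
exact: measurable_funM.
Qed.

(** The integrand is nonnegative, so the finite integral in [L2] amounts to integrability. *)
Lemma L2P u : L2 mu D u <->
  (forall i j, measurable_fun D (fun x => u x i j)) /\
  integrable (fun x => ddot (u x) (u x)).
Proof.
have absE : (\int[mu]_(x in D) `|(EFin \o (fun x => ddot (u x) (u x))) x|)%E =
    (\int[mu]_(x in D) (ddot (u x) (u x))%:E)%E.
  by apply: eq_integral => x _ /=; rewrite ger0_norm ?ddot_ge0.
split=> [[mu_ iu]|[mu_ iu]]; split=> //.
  apply/integrableP; split; first exact/measurable_EFinP/measurable_ddot.
  by rewrite absE.
by move/integrableP : iu => [_]; rewrite absE.
Qed.

(** The bound |a b| <= a^2 + b^2 dominates the product by the sum of the two squared lengths. *)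
Lemma L2_entryM_integrable u w i j k l : L2 mu D u -> L2 mu D w ->
  integrable (fun x => u x i j * w x k l).
Proof.
move=> /L2P[mu_ iu] /L2P[mw iw].
apply: (@le_integrable _ _ _ mu D mD _
  ((EFin \o (fun x => ddot (u x) (u x))) \+ (EFin \o (fun x => ddot (w x) (w x))))).
- exact/measurable_EFinP/measurable_funM.
- move=> x _; rewrite /= lee_fin [leRHS]ger0_norm ?addr_ge0 ?ddot_ge0//.
  rewrite normrM; apply: le_trans (lerD (sqr_entry_le_ddot _ i j) (sqr_entry_le_ddot _ k l)).
  move: (u x i j) (w x k l) => a b.
  rewrite -(real_normK (num_real a)) -(real_normK (num_real b)).
  have := sqr_ge0 (`|a| - `|b|); have := normr_ge0 a; have := normr_ge0 b; nra.
- exact: integrableD.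
Qed.

Lemma integrable_sumR I (s : seq I) (h : I -> T -> R) :
  (forall i, integrable (h i)) -> integrable (fun x => \sum_(i <- s) h i x).
Proof.
move=> ih; have -> : EFin \o (fun x => \sum_(i <- s) h i x) =
    (fun x => \sum_(i <- s) (EFin \o h i) x)%E.
  by apply/funext => x /=; rewrite sumEFin.
exact: integrable_sum.
Qed.

Lemma L2_ddot_integrable u w : L2 mu D u -> L2 mu D w ->
  integrable (fun x => ddot (u x) (w x)).
Proof.
move=> Lu Lw; apply: integrable_sumR => i; apply: integrable_sumR => j.
exact: L2_entryM_integrable.
Qed.

Lemma integrable_lin a b (f g : T -> R) : integrable f -> integrable g ->
  integrable (fun x => a * f x + b * g x).
Proof.
move=> fi gi.
exact: (integrableD mD (integrableZl mD a fi) (integrableZl mD b gi)).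
Qed.

Lemma Rintegral_lin a b (f g : T -> R) : integrable f -> integrable g ->
  \int[mu]_(x in D) (a * f x + b * g x) =
  a * (\int[mu]_(x in D) f x) + b * (\int[mu]_(x in D) g x).
Proof.
move=> fi gi; rewrite RintegralD//.
- by rewrite !RintegralZl.
- exact: (integrableZl mD a fi).
- exact: (integrableZl mD b gi).
Qed.

Lemma L2_lin a b u w : L2 mu D u -> L2 mu D w ->
  L2 mu D (fun x => a *: u x + b *: w x).
Proof.
move=> Lu Lw; have [mu_ _] := Lu; have [mw _] := Lw.
apply/L2P; split=> [i j|].
  under eq_fun do rewrite !mxE.
  by apply: measurable_funD; apply: measurable_funM => //; exact: measurable_cst.
under eq_fun do rewrite ddot_linearl !ddot_linearr.
by do !apply: integrable_lin; apply: L2_ddot_integrable.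
Qed.

Lemma L2dot_linearl a b u1 u2 w : L2 mu D u1 -> L2 mu D u2 -> L2 mu D w ->
  L2dot mu D (fun x => a *: u1 x + b *: u2 x) w =
  a * L2dot mu D u1 w + b * L2dot mu D u2 w.
Proof.
move=> L1 L2_ Lw; rewrite /L2dot; under eq_Rintegral do rewrite ddot_linearl.
by rewrite Rintegral_lin//; exact: L2_ddot_integrable.
Qed.

Lemma L2_sum I (s : seq I) (u : I -> T -> 'M[R]_(m, n)) :
  (forall i, L2 mu D (u i)) -> L2 mu D (fun x => \sum_(i <- s) u i x).
Proof.
move=> Lu; elim: s => [|i s ih].
  under eq_fun do rewrite big_nil.
  apply/L2P; split=> [k l|]; first by under eq_fun do rewrite mxE; exact: measurable_cst.
  under eq_fun do rewrite ddot0l.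
  exact: integrable0.
under eq_fun do rewrite big_cons -[u i _]scale1r -[\sum_(_ <- s) _]scale1r.
exact: L2_lin.
Qed.

End rectangular.

Lemma L2_tr m n (u : T -> 'M[R]_(m, n)) : L2 mu D u -> L2 mu D (fun x => (u x)^T).
Proof.
move=> [mu_ iu]; split=> [i j|]; first by under eq_fun do rewrite mxE; exact: mu_.
by under eq_integral do rewrite ddot_tr.
Qed.

(** In the basis of the [delta_mx i j], K (u x) is a finite sum of entries of u x times constant
    matrices. *)
Lemma L2_linear_comp m n p q (K : {linear 'M[R]_(m, n) -> 'M[R]_(p, q)})
    (u : T -> 'M[R]_(m, n)) : L2 mu D u -> L2 mu D (fun x => K (u x)).
Proof.
move=> Lu; have -> : (fun x => K (u x)) =
    (fun x => \sum_i \sum_j (u x i j *: K (delta_mx i j))).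
  apply/funext => x; rewrite {1}(matrix_sum_delta (u x)) linear_sum.
  apply: eq_bigr => i _; rewrite linear_sum; apply: eq_bigr => j _.
  by rewrite linearZ.
apply: L2_sum => i; apply: L2_sum => j; have [mu_ _] := Lu.
apply/L2P; split=> [k l|].
  under eq_fun do rewrite mxE.
  apply: measurable_funM => //.
(* The zero terms give the two-term shape that the lemmas on linear combinations expect. *)
have -> : (fun x => ddot (u x i j *: K (delta_mx i j)) (u x i j *: K (delta_mx i j)))
    = (fun x => ddot (K (delta_mx i j)) (K (delta_mx i j)) * (u x i j * u x i j) + 0 * 0).
  apply/funext => x; rewrite -[X in ddot X]addr0 -[X in ddot _ X]addr0.
  rewrite -[X in _ *: _ + X](scale0r (K (delta_mx i j))) ddot_linearl !ddot_linearr.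
  ring.
apply: (@integrable_lin _ 0 _ (cst 0)); last exact: integrable0.
exact: L2_entryM_integrable.
Qed.

End L2_theory.

(** [weak_grad] is a choice with default 0; for v in [H1] a weak gradient exists, so the chosen
    field is a genuine one, in [L2]. *)
Lemma strain_L2 (R : realType) (Omega : set (vec3 R)) v :
  measurable Omega -> H1 Omega v -> L2 lebesgue3 Omega (strain Omega v).
Proof.
move=> mO [_ [G LG wG]].
have [Lw _] : [set G | L2 lebesgue3 Omega G /\ is_weak_grad Omega v G]
  (weak_grad Omega v) by apply: xgetPex; exists G.
rewrite /strain; under eq_fun do rewrite scalerDr.
by apply: L2_lin => //; exact: L2_tr.
Qed.

(** * The inverse of C on symmetric matrices *)

Section symmetric_inverse.
Context {R : realType} (C : {linear 'M[R]_3 -> 'M[R]_3}).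
Hypothesis C_spd : symm_posdef C.
Implicit Types A B : 'M[R]_3.

Lemma symmx_lin a b A B : symmx A -> symmx B -> symmx (a *: A + b *: B).
Proof. by rewrite /symmx/= => sA sB; rewrite linearD !linearZ/= sA sB. Qed.

(** Positive definiteness bounds delta times the squared length of B by 0. *)
Let C_inj B : symmx B -> C B = 0 -> B = 0.
Proof.
move=> sB CB0; have [_ _ [delta d0 /(_ _ sB)]] := C_spd.
rewrite CB0 => h; apply: ddot_eq0; move: h.
by rewrite ddot0l pmulr_rle0.
Qed.

(* Extending C by the identity on antisymmetric matrices makes it invertible on
   all matrices; the inverse K of that extension restricts to [symm_inv C]. *)
Lemma symm_inv_linear : exists K : {linear 'M[R]_3 -> 'M[R]_3},
  forall A, symmx A -> [/\ symm_inv C A = K A, symmx (K A) & C (K A) = A].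
Proof.
have [Csym _ _] := C_spd.
pose s (A : 'M[R]_3) : 'M[R]_3 := 2^-1 *: (A + A^T).
have ss A : symmx (s A) by rewrite /symmx /s /= linearZ linearD/= trmxK addrC.
have as_ A : (A - s A)^T = - (A - s A).
  rewrite linearB/= ss /s; apply/matrixP => i j; rewrite !mxE; lra.
pose Ce A := C (s A) + (A - s A).
have Ce_lin : linear Ce.
  move=> a A B; have sl : s (a *: A + B) = a *: s A + s B.
    by rewrite /s; apply/matrixP => i j; rewrite !mxE; lra.
  rewrite /Ce sl linearP; apply/matrixP => i j; rewrite !mxE; lra.
have sym_asym A B : symmx A -> B^T = - B -> symmx (A + B) -> B = 0.
  rewrite /symmx/= linearD/= => -> -> /addrI E; apply/matrixP => i j; rewrite mxE.
  by have := congr1 (fun M : 'M[R]_3 => M i j) E; rewrite !mxE; lra.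
(* C preserves symmetry, so Ce A and A have the same antisymmetric part, which vanishes when Ce A is
   symmetric. *)
have CeP A : symmx (Ce A) -> symmx A /\ C A = Ce A.
  move=> sCe; have A0 := sym_asym _ _ (Csym _ (ss A)) (as_ A) sCe.
  have -> : Ce A = C (s A) by rewrite /Ce A0 addr0.
  have E : A = s A by apply/eqP; rewrite -subr_eq0 A0.
  by split; [rewrite E; exact: ss|rewrite -E].
pose L := GRing.isLinear.Build _ _ _ _ Ce Ce_lin.
pose CeL : {linear _ -> _} := HB.pack Ce L.
pose f := linfun CeL.
have kf : lker f == 0%VS.
  apply/lker0P => A B; rewrite !lfunE/= => E.
  have : Ce (A - B) = 0 by rewrite -[Ce]/(CeL : _ -> _) linearB/= E subrr.
  move=> E0; have [|sAB] := CeP (A - B); first by rewrite E0 /symmx/= linear0.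
  by rewrite E0 => /(C_inj sAB) /eqP; rewrite subr_eq0 => /eqP.
(* In finite dimension, injectivity of the endomorphism f makes its inverse a right inverse as
   well. *)
have KE A : Ce (f^-1%VF A) = A by have := lker0_lfunVK kf A; rewrite lfunE.
exists (f^-1%VF : {linear _ -> _}) => A sA.
have [sK CK] := CeP (f^-1%VF A) ltac:(by rewrite KE).
rewrite KE in CK; split=> //.
(* The value chosen by [symm_inv] is symmetric with image A, so injectivity of C on [symmx]
   identifies it with K A. *)
have [sB CB] : [set B | symmx B /\ C B = A] (symm_inv C A).
  by apply: xgetPex; exists (f^-1%VF A).
apply/eqP; rewrite -subr_eq0; apply/eqP/C_inj.
  by have := symmx_lin 1 (-1) sB sK; rewrite scale1r scaleN1r.
by rewrite linearB/= CB CK subrr.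
Qed.

(** With B = K A and A = C B, the value is the quadratic form of C at B. *)
Lemma symm_inv_ge0 A : symmx A -> 0 <= ddot (symm_inv C A) A.
Proof.
move=> sA; have [K /(_ _ sA)[-> sK CK]] := symm_inv_linear.
rewrite -{2}CK ddotC; have [_ _ [delta d0 /(_ _ sK)]] := C_spd.
by apply: le_trans; rewrite mulr_ge0 ?ddot_ge0// ltW.
Qed.

(** For the quadratic form q of the inverse, the right side minus the left is t (1 - t) q (A -
    B). *)
Lemma symm_inv_convex t A B : 0 <= t <= 1 -> symmx A -> symmx B ->
  ddot (symm_inv C (t *: A + (1 - t) *: B)) (t *: A + (1 - t) *: B) <=
  t * ddot (symm_inv C A) A + (1 - t) * ddot (symm_inv C B) B.
Proof.
move=> /andP[t0 t1] sA sB; have [K KP] := symm_inv_linear.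
have sT := symmx_lin t (1 - t) sA sB.
have sD := symmx_lin 1 (-1) sA sB.
have := symm_inv_ge0 sD.
have [-> _ _] := KP _ sA; have [-> _ _] := KP _ sB.
have [-> _ _] := KP _ sT; have [-> _ _] := KP _ sD.
rewrite !linearD !linearZ/= !ddot_linearl !ddot_linearr => h.
have : 0 <= t * (1 - t) by rewrite mulr_ge0 ?subr_ge0.
move: h; move: (ddot _ _) (ddot _ _) (ddot _ _) (ddot _ _) => a b c e; nra.
Qed.

End symmetric_inverse.

(** * Convexity of the admissible stresses and of the energy *)

Section plasticity_convexity.
Context {R : realType} (Omega GammaD GammaN : set (vec3 R)).
Context (C : {linear 'M[R]_3 -> 'M[R]_3}) (Phi : 'M[R]_3 -> R) (gamma : R).
Context (F f : vec3 R -> 'rV[R]_3).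
Hypothesis mOmega : measurable Omega.
Implicit Types tau : vec3 R -> 'M[R]_3.

Lemma stresses_lin a b tau1 tau2 : stresses Omega tau1 -> stresses Omega tau2 ->
  stresses Omega (fun x => a *: tau1 x + b *: tau2 x).
Proof.
move=> [L1 s1] [L2_ s2]; split; first exact: L2_lin.
by move=> x Ox; apply: symmx_lin; [exact: s1|exact: s2].
Qed.

(** The equilibrium equation is linear jointly in load factor and stress; [strain_L2] lets the work
    integral be split. *)
Lemma equilibrium_lin a b z1 z2 tau1 tau2 :
  equilibrium Omega GammaD GammaN F f z1 tau1 ->
  equilibrium Omega GammaD GammaN F f z2 tau2 ->
  equilibrium Omega GammaD GammaN F f (a * z1 + b * z2)
    (fun x => a *: tau1 x + b *: tau2 x).
Proof.
move=> [S1 e1] [S2 e2]; split; first exact: stresses_lin.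
move=> v Vv; have Lv := strain_L2 mOmega Vv.1.
have [L1 _] := S1; have [L2_ _] := S2.
by rewrite L2dot_linearl// e1// e2// mulrDl !mulrA.
Qed.

(** At almost every point convexity gives the bound t gamma + (1 - t) gamma = gamma. *)
Lemma plastic_convex t tau1 tau2 : convex_function symmx Phi -> 0 <= t <= 1 ->
  plastic Omega Phi gamma tau1 -> plastic Omega Phi gamma tau2 ->
  plastic Omega Phi gamma (fun x => t *: tau1 x + (1 - t) *: tau2 x).
Proof.
move=> cPhi /andP[t0 t1] [S1 p1] [S2 p2]; split; first exact: stresses_lin.
have ae_filter := ae_filter_ringOfSetsType (@lebesgue3 R).
apply: filterS2 p1 p2 => x p1 p2 Ox.
have := cPhi (Itv01 t0 t1) (tau1 x) (tau2 x).
rewrite !inE => /(_ (S1.2 _ Ox) (S2.2 _ Ox)) /le_trans; apply.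
have := p1 Ox; have := p2 Ox => h2 h1.
rewrite convRE/=.
apply: (@le_trans _ _ (t * gamma + (1 - t) * gamma)); last by rewrite -mulrDl subrKC mul1r.
by rewrite lerD// ler_wpM2l// subr_ge0.
Qed.

Hypothesis C_spd : symm_posdef C.

(** The square cancels the root because the integral is nonnegative. *)
Lemma energyE tau : stresses Omega tau ->
  energy Omega C tau = 2^-1 * L2dot lebesgue3 Omega (fun x => symm_inv C (tau x)) tau.
Proof.
move=> [_ sym]; rewrite /energy /Cinv_norm sqr_sqrtr//.
by apply: Rintegral_ge0 => x Ox; apply: symm_inv_ge0 => //; exact: sym.
Qed.

Lemma energy_convex t tau1 tau2 : 0 <= t <= 1 ->
  stresses Omega tau1 -> stresses Omega tau2 ->
  energy Omega C (fun x => t *: tau1 x + (1 - t) *: tau2 x) <=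
  t * energy Omega C tau1 + (1 - t) * energy Omega C tau2.
Proof.
move=> t01 S1 S2; have S := stresses_lin t (1 - t) S1 S2.
have [K KP] := symm_inv_linear C_spd.
(* On Omega [symm_inv C] agrees with the linear map K, and composition with K preserves [L2]. *)
have int tau : stresses Omega tau -> lebesgue3.-integrable Omega
    (EFin \o (fun x => ddot (symm_inv C (tau x)) (tau x))).
  move=> [Ltau sym].
  have iK : lebesgue3.-integrable Omega (EFin \o (fun x => ddot (K (tau x)) (tau x))).
    by apply: L2_ddot_integrable => //; exact: L2_linear_comp.
  apply: eq_integrable iK => // x; rewrite inE => Ox /=.
  by have [-> _ _] := KP _ (sym _ Ox).
rewrite !energyE// mulrCA [X in _ <= _ + X]mulrCA -mulrDr ler_wpM2l//.
rewrite -Rintegral_lin//; try exact: int.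
apply: le_Rintegral => //; first exact: int.
  by apply: integrable_lin => //; exact: int.
move=> x Ox; apply: symm_inv_convex => //; [exact: S1.2|exact: S2.2].
Qed.

End plasticity_convexity.

(** * Reduction to a real convex function of the load factor *)

Theorem theorem3p1 (R : realType)
    (Omega GammaD GammaN : set (vec3 R))
    (C : {linear 'M[R]_3 -> 'M[R]_3})
    (Phi : 'M[R]_3 -> R) (gamma : R)
    (F f : vec3 R -> 'rV[R]_3)
    (sigma : R -> vec3 R -> 'M[R]_3) (psi : R -> R)
    (D := load_domain Omega GammaD GammaN Phi gamma F f)
    (zlim := zeta_lim Omega GammaD GammaN Phi gamma F f)
    (phi := min_energy Omega GammaD GammaN C Phi gamma F f sigma)
    (Omega_domain :
       [/\ open Omega, connected Omega, bounded_set Omega & Omega !=set0])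
    (Omega_lipschitz : lipschitz_boundary Omega)
    (boundary_split : boundary Omega = closure GammaD `|` closure GammaN)
    (GammaD_open : relatively_open (boundary Omega) GammaD)
    (GammaN_open : relatively_open (boundary Omega) GammaN)
    (Gamma_disj : GammaD `&` GammaN = set0)
    (GammaD_gt0 : (0 < surface_measure GammaD)%E)
    (C_spd : symm_posdef C)
    (Phi_cont : {within symmx, continuous Phi})
    (Phi_convex : convex_function symmx Phi)
    (Phi0 : Phi 0 = 0)
    (gamma_gt0 : 0 < gamma)
    (F_L2 : L2 lebesgue3 Omega F)
    (f_L2 : L2 surface_measure GammaN f)
    (Ff_gt0 : 0 < L2norm lebesgue3 Omega F + L2norm surface_measure GammaN f)
    (zlim_gt0 : (0 < zlim)%E)
    (sigma_min : forall zeta, D zeta ->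
       unique_minimizer (ae_eq_on Omega)
         (equilibrium Omega GammaD GammaN F f zeta `&` plastic Omega Phi gamma)
         (energy Omega C) (sigma zeta))
    (psi_min : forall alpha, 0 <= alpha ->
       unique_minimizer eq D
         (fun zeta => (phi zeta - (alpha * zeta)%:E)%E) (psi alpha)) :
  [/\ {within `[0, +oo[, continuous psi},
      {in `[0, +oo[ &, {homo psi : a b / a <= b}} &
      (psi alpha)%:E @[alpha --> +oo] --> zlim].
Proof.
have mO : measurable Omega by apply: vec3_open_measurable; case: Omega_domain.
pose e zeta := energy Omega C (sigma zeta).
have phiE zeta : D zeta -> phi zeta = (e zeta)%:E.
  by move=> Dz; rewrite /phi /min_energy mem_set.
have e_convex : convex_on D e.
  move=> t x y t01 Dx Dy.
  have [[ex px] _ _] := sigma_min _ Dx; have [[ey py] _ _] := sigma_min _ Dy.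
  (* The combination of sigma x and sigma y competes at the load t x + (1 - t) y, so its energy
     bounds the minimal one there. *)
  have adm := conj (equilibrium_lin mO t (1 - t) ex ey) (plastic_convex mO Phi_convex t01 px py).
  have Dxy : D (t * x + (1 - t) * y).
    have /andP[t0 t1] := t01; split; last by eexists; exact: adm.
    by rewrite addr_ge0// mulr_ge0 ?subr_ge0//; [exact: Dx.1|exact: Dy.1].
  split=> //; have [_ /(_ _ adm) + _] := sigma_min _ Dxy => /le_trans; apply.
  exact: (energy_convex mO C_spd t01 ex.1 ey.1).
(* Competitors lie in D, where phi is finite, so minimality passes from extended to real values. *)
have psi_min' a : 0 <= a -> unique_minimizer eq D (fun z => e z - a * z) (psi a).
  move=> a0; have [Da mina uniqa] := psi_min _ a0; split=> // z Dz.
    by have := mina _ Dz; rewrite !phiE// -!EFinB lee_fin.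
  by move=> h; apply: uniqa => //; rewrite !phiE// -!EFinB lee_fin.
split.
- exact: tilted_minimizer_continuous psi_min'.
- exact: tilted_minimizer_homo psi_min'.
- apply: tilted_minimizer_cvg psi_min' _ => // z _.
  by rewrite mulr_ge0// sqr_ge0.
Qed.
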